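(* Let $I$ be a set and let $A=\langle A;\cdot,0,(\Diamond_i)_{i\in I},(d_{i,k})_{i,k\in I}\rangle$ be an $I$-dimensional cylindric quasi-implication algebra. Then its $I$-dimensional MacLaren frame $X^M_A=\langle A\setminus\{0\};\perp^M,(R^M_i)_{i\in I},(\Delta^M_{i,k})_{i,k\in I}\rangle$ is an $I$-dimensional cylindric orthoframe.
   Context: A quasi-implication algebra is a set $A$ with a binary operation $\cdot$ satisfying (1) $(x\cdot y)\cdot x=x$; (2) $(x\cdot y)\cdot(x\cdot z)=(y\cdot x)\cdot(y\cdot z)$; (3) $((x\cdot y)\cdot(y\cdot x))\cdot x=((y\cdot x)\cdot(x\cdot y))\cdot y$. In any quasi-implication algebra $x\cdot x=y\cdot y$ for all $x,y$, and one sets $1:=x\cdot x$. A bounded quasi-implication algebra is a quasi-implication algebra with a constant $0$ such that $0\cdot x=1$ for all $x$. A monadic quasi-implication algebra $\langle A;\cdot,0,\Diamond\rangle$ is a bounded quasi-implication algebra $\langle A;\cdot,0\rangle$ with a unary operation $\Diamond$ satisfying: (a) $\Diamond\Diamond x\cdot\Diamond x=1$ and $x\cdot\Diamond x=1$; (b) $\Diamond(\Diamond x\cdot 0)=\Diamond x\cdot 0$ and $\Diamond 0=0$; (c) $\Diamond(((x\cdot 0)\cdot(y\cdot 0))\cdot x)=((\Diamond x\cdot 0)\cdot(\Diamond y\cdot 0))\cdot\Diamond x$. ($\Diamond$ binds more tightly than $\cdot$.) An $I$-dimensional cylindric quasi-implication algebra is a structure $\langle A;\cdot,0,(\Diamond_i)_{i\in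 I},(d_{i,k})_{i,k\in I}\rangle$, with $d_{i,k}\in A$, such that: (1) $\langle A;\cdot,0,\Diamond_i\rangle$ is a monadic quasi-implication algebra for all $i\in I$; (2) $\Diamond_i\Diamond_k x=\Diamond_k\Diamond_i x$ for all $i,k\in I$ and $x\in A$; (3) $d_{i,k}=d_{k,i}$ and $d_{i,i}=1$ for all $i,k\in I$; (4) if $i\ne k$ and $l\neq k$ then $\Diamond_k(((d_{i,k}\cdot d_{k,l})\cdot(d_{i,k}\cdot 0))\cdot 0)=d_{i,l}$. The $I$-dimensional MacLaren frame $X^M_A$ has underlying set $A\setminus\{0\}$ and, for $x,y\in A\setminus\{0\}$ and $i,k\in I$: $x\perp^M y$ iff $x\cdot(y\cdot 0)=1$; $xR^M_iy$ iff $y\cdot\Diamond_i x=1$; $\Delta^M_{i,k}=\psi(d_{i,k})$, where $\psi(x)=\{y\in A\setminus\{0\}: y\cdot x=1\}$ for $x\in A$. An orthoframe is a pair $\langle X;\perp\rangle$ with $X$ a set and $\perp\subseteq X^2$ irreflexive and symmetric; for $U\subseteq X$, $U^\perp=\{x\in X: x\perp y\text{ for all }y\in U\}$. For a binary relation $R$ on $X$ and $U\subseteq X$, $R[U]=\{y\in X: xRy\text{ for some }x\in U\}$. A monadic orthoframe is a triple $\langle X;\perp,R\rangle$ such that $\langle X;\perp\rangle$ is an orthoframe, $R$ is a reflexive and transitive binary relation on $X$, and $R[R[\{x\}]^\perp]\subseteq R[\{x\}]^\perp$ for all $x\in X$. An $I$-dimensional cylindric orthoframe is a structure $\langle X;\perp,(R_i)_{i\in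 I},(\Delta_{i,k})_{i,k\in I}\rangle$ such that for all $i,k,l\in I$: (1) $\langle X;\perp,R_i\rangle$ is a monadic orthoframe; (2) $R_i\circ R_k=R_k\circ R_i$ (composition of relations); (3) $\Delta_{i,k}\subseteq X$ with $\Delta_{i,k}=\Delta_{k,i}=\Delta_{i,k}^{\perp\perp}$ and $\Delta_{i,i}=X$; (4) if $i\ne k$ and $l\neq k$, then $R_k[\Delta_{i,k}\cap\Delta_{k,l}]=\Delta_{i,l}$. *)

(* Defs.v *)
From Stdlib Require Import RelationClasses.
From mathcomp Require Import all_boot.
From mathcomp Require Import boolp classical_sets.

Set Implicit Arguments.
Unset Strict Implicit.
Unset Printing Implicit Defensive.

Local Open Scope classical_set_scope.


Section QuasiImplication.
Context {A : Type}.
Implicit Type imp : A -> A -> A.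

Record quasi_implication_algebra (imp : A -> A -> A) : Prop := {
  qia_contract : forall x y, imp (imp x y) x = x;
  qia_exchange : forall x y z,
    imp (imp x y) (imp x z) = imp (imp y x) (imp y z);
  qia_symm : forall x y,
    imp (imp (imp x y) (imp y x)) x = imp (imp (imp y x) (imp x y)) y }.

Lemma imp_self_const imp : quasi_implication_algebra imp ->
  forall x y, imp x x = imp y y.
Proof.
case=> c e s.
have absorb x y : imp x (imp x y) = imp x y.
  by have := c (imp x y) x; rewrite (c x y).
have swap x y z : imp x (imp (imp x y) z) = imp (imp x y) (imp x z).
  by have := e (imp x y) x z; rewrite (c x y) absorb.
have sq x y : imp (imp x y) (imp x y) = imp y y.
  by rewrite (e x y y) -swap (c y x).
have const_r x y : imp x (imp y y) = imp y y.
  by have := swap x y (imp x y); rewrite absorb !sq.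
move=> x y; have := s (imp x x) (imp y y).
by rewrite !const_r.
Qed.

(* The constant 1 is x . x for an arbitrary x (see imp_self_const); here x is
   taken to be 0. *)
Definition one imp (zero : A) : A := imp zero zero.

Record bounded_quasi_implication_algebra
    (imp : A -> A -> A) (zero : A) : Prop := {
  bqia_qia : quasi_implication_algebra imp;
  bqia_zero : forall x, imp zero x = one imp zero }.

Record monadic_quasi_implication_algebra
    (imp : A -> A -> A) (zero : A) (dia : A -> A) : Prop := {
  mqia_bounded : bounded_quasi_implication_algebra imp zero;
  mqia_dia_idem : forall x, imp (dia (dia x)) (dia x) = one imp zero;
  mqia_dia_incr : forall x, imp x (dia x) = one imp zero;
  mqia_dia_compl : forall x, dia (imp (dia x) zero) = imp (dia x) zero;
  mqia_dia_zero : dia zero = zero;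
  mqia_dia_join : forall x y,
    dia (imp (imp (imp x zero) (imp y zero)) x) =
    imp (imp (imp (dia x) zero) (imp (dia y) zero)) (dia x) }.

Record cylindric_quasi_implication_algebra (I : Type)
    (imp : A -> A -> A) (zero : A) (dia : I -> A -> A) (d : I -> I -> A)
    : Prop := {
  cqia_monadic : forall i, monadic_quasi_implication_algebra imp zero (dia i);
  cqia_dia_comm : forall i k x, dia i (dia k x) = dia k (dia i x);
  cqia_diag_sym : forall i k, d i k = d k i;
  cqia_diag_refl : forall i, d i i = one imp zero;
  cqia_diag_dia : forall i k l, i <> k -> l <> k ->
    dia k (imp (imp (imp (d i k) (d k l)) (imp (d i k) zero)) zero) = d i l }.

End QuasiImplication.

Section Orthoframes.
Context {X : Type}.

Record orthoframe (perp : X -> X -> Prop) : Prop := {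
  perp_irrefl : Irreflexive perp;
  perp_sym : Symmetric perp }.

Definition orthocompl (perp : X -> X -> Prop) (U : set X) : set X :=
  [set x | forall y, U y -> perp x y].

Definition rel_image (R : X -> X -> Prop) (U : set X) : set X :=
  [set y | exists2 x, U x & R x y].

Definition rel_comp (R S : X -> X -> Prop) : X -> X -> Prop :=
  fun x y => exists2 z, R x z & S z y.

Record monadic_orthoframe (perp R : X -> X -> Prop) : Prop := {
  mof_orthoframe : orthoframe perp;
  mof_refl : Reflexive R;
  mof_trans : Transitive R;
  mof_perp : forall x,
    rel_image R (orthocompl perp (rel_image R [set x]))
      `<=` orthocompl perp (rel_image R [set x]) }.

Record cylindric_orthoframe (I : Type) (perp : X -> X -> Prop)
    (R : I -> X -> X -> Prop) (Delta : I -> I -> set X) : Prop := {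
  cof_monadic : forall i, monadic_orthoframe perp (R i);
  cof_comm : forall i k, rel_comp (R i) (R k) = rel_comp (R k) (R i);
  cof_diag_sym : forall i k, Delta i k = Delta k i;
  cof_diag_closed : forall i k,
    Delta i k = orthocompl perp (orthocompl perp (Delta i k));
  cof_diag_refl : forall i, Delta i i = setT;
  cof_diag_image : forall i k l, i <> k -> l <> k ->
    rel_image (R k) (Delta i k `&` Delta k l) = Delta i l }.

End Orthoframes.

Section MacLarenFrame.
Context {A : Type} (imp : A -> A -> A) (zero : A).

Definition maclaren_carrier : Type := {x : A | x <> zero}.

Definition maclaren_psi (x : A) : set maclaren_carrier :=
  [set y | imp (sval y) x = one imp zero].

Definition maclaren_perp (x y : maclaren_carrier) : Prop :=
  imp (sval x) (imp (sval y) zero) = one imp zero.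

Definition maclaren_rel (I : Type) (dia : I -> A -> A) (i : I)
    (x y : maclaren_carrier) : Prop :=
  imp (sval y) (dia i (sval x)) = one imp zero.

Definition maclaren_diag (I : Type) (d : I -> I -> A) (i k : I)
  : set maclaren_carrier := maclaren_psi (d i k).

End MacLarenFrame.

Arguments maclaren_psi {A} imp zero x.
Arguments maclaren_perp {A} imp zero x y.
Arguments maclaren_rel {A} imp zero {I} dia i x y.
Arguments maclaren_diag {A} imp zero {I} d i k.

(* Main.v *)
Require Import Defs.
From mathcomp Require Import all_boot.
From mathcomp Require Import boolp classical_sets.

(** A bounded quasi-implication algebra is an orthomodular lattice in disguise:
    [x . y] is the Sasaki hook [x' \/ (x /\ y)], the order is [x . y = 1], the
    complement is [x' = x . 0], the join is [(x' . y') . x] and the meet is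
    [((x . y) . x')'].  Four order-theoretic facts are extracted from the
    equations to serve the frame: [.] defines a partial
    order ([le_trans], [le_anti]); [x'] is an antitone involution with
    [x <= x'] only for [x = 0] ([complK], [compl_anti], [le_compl_zero]); the
    meet is a greatest lower bound ([meet_le_l], [meet_le_r], [le_meet]); and
    the join satisfies [x <= x \/ y], with [x \/ y = y] when [x <= y]
    ([le_join_l], [join_of_le]).  The last one turns the additivity of a
    quantifier into its monotonicity ([dia_mono]).

    In the frame every set involved is the set of nonzero elements of a
    principal downset.  The relation [R_i] sends [x] to the downset of
    [dia_i x], and orthocomplementation sends the downset of [a] to that of
    [a'] ([orthocompl_psi]).  The frame conditions thus become inequalities
    about [dia_i], up to one point: the witnesses must be nonzero.  The
    witness for the commutation of the relations is [dia_k x], nonzero because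
    it lies above [x]; the one for the diagonal condition is
    [d_ik /\ d_kl], nonzero because [dia_k 0 = 0]. *)

Set Implicit Arguments.
Unset Strict Implicit.
Unset Printing Implicit Defensive.

Local Open Scope classical_set_scope.

(** * The order and the lattice operations of a bounded algebra *)

Section BoundedAlgebra.
Context {A : Type} {imp : A -> A -> A} {zero : A}.
Context (hB : bounded_quasi_implication_algebra imp zero).

Local Notation "x · y" := (imp x y) (at level 40, left associativity).
Local Notation "1" := (Defs.one imp zero).
Local Notation "x ^c" := (imp x zero) (at level 2, format "x ^c").
Local Notation "x ⊑ y" := (imp x y = Defs.one imp zero) (at level 70).

Let hQ := bqia_qia hB.
Let contract := qia_contract hQ.
Let exchange := qia_exchange hQ.

Lemma le_refl x : x ⊑ x.
Proof. exact: imp_self_const hQ x zero. Qed.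

Lemma imp_absorb x y : x · (x · y) = x · y.
Proof. by have := contract (x · y) x; rewrite (contract x y). Qed.

Lemma one_imp x : 1 · x = x.
Proof. by rewrite -(le_refl x) contract. Qed.

Lemma le_one x : x ⊑ 1.
Proof. by rewrite -{1}(le_refl x) imp_absorb le_refl. Qed.

Lemma le_anti x y : x ⊑ y -> y ⊑ x -> x = y.
Proof.
by move=> xy yx; have := qia_symm hQ x y; rewrite xy yx le_refl !one_imp.
Qed.

(** The exchange law loses its left factor when [x <= y]; transitivity and
    the monotonicity properties of the hook all rest on exchange in this way. *)
Lemma imp_of_le x y z : x ⊑ y -> x · z = (y · x) · (y · z).
Proof. by move=> xy; rewrite -exchange xy one_imp. Qed.

Lemma le_trans y x z : x ⊑ y -> y ⊑ z -> x ⊑ z.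
Proof. by move=> xy yz; rewrite (imp_of_le z xy) yz le_one. Qed.

Lemma le_imp_of_le v u : v ⊑ u -> v ⊑ u · v.
Proof. by move=> vu; rewrite (imp_of_le _ vu) imp_absorb le_refl. Qed.

Lemma imp_mono_r a u v : u ⊑ v -> a · u ⊑ a · v.
Proof. by move=> uv; rewrite exchange uv le_one. Qed.

(** The hook is not antitone on the left in general; it is so above the right
    argument, where it coincides with [s' \/ z]. *)
Lemma imp_anti_l z t s : z ⊑ t -> t ⊑ s -> s · z ⊑ t · z.
Proof.
by move=> zt ts; rewrite (imp_of_le z ts); exact/le_imp_of_le/imp_mono_r.
Qed.

Lemma compl_le_imp x z : x^c ⊑ x · z.
Proof. by rewrite exchange !(bqia_zero hB) le_refl. Qed.

Lemma complK x : x^c^c = x.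
Proof.
by have := qia_symm hQ x zero; rewrite (bqia_zero hB) le_one !one_imp.
Qed.

Lemma compl_anti x y : x ⊑ y -> y^c ⊑ x^c.
Proof.
move=> xy; rewrite (imp_of_le zero xy).
exact/le_imp_of_le/compl_le_imp.
Qed.

Lemma le_compl_sym x y : x ⊑ y^c -> y ⊑ x^c.
Proof. by move=> /compl_anti; rewrite complK. Qed.

Lemma le_compl_zero x : x ⊑ x^c -> x = zero.
Proof. by rewrite imp_absorb => xc; rewrite -(complK x) xc one_imp. Qed.

Lemma le_zero x : x ⊑ zero -> x = zero.
Proof. by move=> x0; apply: le_anti => //; exact: bqia_zero hB x. Qed.

Lemma le_join_l x y : x ⊑ (x^c · y^c) · x.
Proof.
apply: le_imp_of_le.
by rewrite -{1}(complK x); exact: compl_le_imp.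
Qed.

Lemma join_of_le x y : x ⊑ y -> (x^c · y^c) · x = y.
Proof.
move=> /compl_anti yx.
by have := imp_of_le zero yx; rewrite !complK.
Qed.

Lemma meet_le_l a b : ((a · b) · a^c)^c ⊑ a.
Proof.
rewrite -{3}(complK a).
exact/compl_anti/le_imp_of_le/compl_le_imp.
Qed.

(** The exchange law with third argument [0] says that the meet is
    commutative. *)
Lemma meet_le_r a b : ((a · b) · a^c)^c ⊑ b.
Proof. by rewrite exchange; exact: meet_le_l. Qed.

(** For [w <= a], the complement [w'] equals [(a . w) . a'], which has the
    shape of the complement of the meet with [b] replaced by [w]. *)
Lemma le_meet a b w : w ⊑ a -> w ⊑ b -> w ⊑ ((a · b) · a^c)^c.
Proof.
move=> wa wb; apply: le_compl_sym.
rewrite (imp_of_le zero wa).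
by apply: imp_anti_l; [exact: compl_le_imp | exact: imp_mono_r].
Qed.

(** * Orthocomplements of principal downsets *)

Lemma maclaren_orthoframe : orthoframe (maclaren_perp imp zero).
Proof.
split; first by move=> x /le_compl_zero; exact: (svalP x).
by move=> x y; exact: le_compl_sym.
Qed.

(** If [a <> 0] then [a] itself belongs to its downset, so that being
    orthogonal to the downset is being orthogonal to [a]. If [a = 0] the
    downset is empty, and its orthocomplement is everything, as [0' = 1]. *)
Lemma orthocompl_psi a :
  orthocompl (maclaren_perp imp zero) (maclaren_psi imp zero a) =
  maclaren_psi imp zero a^c.
Proof.
apply/seteqP; split=> x /= hx; last first.
  by move=> y ya; exact: le_trans hx (compl_anti ya).
have [->|a0] := pselect (a = zero); first exact: le_one.
exact: (hx (exist _ a a0) (le_refl a)).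
Qed.

Lemma psi_closed a :
  maclaren_psi imp zero a =
  orthocompl (maclaren_perp imp zero)
    (orthocompl (maclaren_perp imp zero) (maclaren_psi imp zero a)).
Proof. by rewrite !orthocompl_psi complK. Qed.

End BoundedAlgebra.

(** * Quantifiers *)

Section MonadicAlgebra.
Context {A : Type} {imp : A -> A -> A} {zero : A} {dia : A -> A}.
Context (hM : monadic_quasi_implication_algebra imp zero dia).

Local Notation "x ⊑ y" := (imp x y = Defs.one imp zero) (at level 70).

Let hB := mqia_bounded hM.

Lemma dia_mono x y : x ⊑ y -> dia x ⊑ dia y.
Proof.
move=> xy; rewrite -(join_of_le hB xy) (mqia_dia_join hM).
exact: le_join_l.
Qed.

Lemma le_dia_trans x y z : y ⊑ dia x -> z ⊑ dia y -> z ⊑ dia x.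
Proof.
move=> /dia_mono yx zy; apply: (le_trans hB zy).
exact: (le_trans hB yx (mqia_dia_idem hM x)).
Qed.

Lemma dia_neq_zero x : x <> zero -> dia x <> zero.
Proof.
by move=> x0 dx0; apply/x0/(le_zero hB); rewrite -{1}dx0 (mqia_dia_incr hM).
Qed.

End MonadicAlgebra.

Lemma maclaren_monadic (I A : Type) (imp : A -> A -> A) (zero : A)
    (dia : I -> A -> A) (i : I) :
  monadic_quasi_implication_algebra imp zero (dia i) ->
  monadic_orthoframe (maclaren_perp imp zero) (maclaren_rel imp zero dia i).
Proof.
move=> hM; have hB := mqia_bounded hM.
have image1 x : rel_image (maclaren_rel imp zero dia i) [set x] =
    maclaren_psi imp zero (dia i (sval x)).
  by apply/seteqP; split=> [y [_ -> //]|y xy]; exists x.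
split.
- exact: maclaren_orthoframe.
- by move=> x; exact: mqia_dia_incr hM _.
- by move=> x y z; exact: le_dia_trans.
move=> x; rewrite image1 (orthocompl_psi hB) => z [w wx zw].
(* The complement of a closed element is closed. *)
apply: (le_trans hB zw); rewrite -(mqia_dia_compl hM).
exact: (dia_mono hM wx).
Qed.

(** * The cylindric frame *)

Lemma maclaren_rel_comm (I A : Type) (imp : A -> A -> A) (zero : A)
    (dia : I -> A -> A) (i k : I) :
  monadic_quasi_implication_algebra imp zero (dia k) ->
  (forall x, dia i (dia k x) = dia k (dia i x)) ->
  forall x y,
    rel_comp (maclaren_rel imp zero dia i) (maclaren_rel imp zero dia k) x y ->
    rel_comp (maclaren_rel imp zero dia k) (maclaren_rel imp zero dia i) x y.
Proof.
move=> hk comm x y [z xz zy]; have hB := mqia_bounded hk.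
exists (exist _ (dia k (sval x)) (dia_neq_zero hk (svalP x))).
  exact: le_refl.
rewrite /maclaren_rel /= comm.
exact: (le_trans hB zy (dia_mono hk xz)).
Qed.

Theorem theorem4p7 (I A : Type) (imp : A -> A -> A) (zero : A)
    (dia : I -> A -> A) (d : I -> I -> A)
    (hA : cylindric_quasi_implication_algebra imp zero dia d) :
  cylindric_orthoframe (X := maclaren_carrier zero)
    (maclaren_perp imp zero)
    (maclaren_rel imp zero dia)
    (maclaren_diag imp zero d).
Proof.
have hM := cqia_monadic hA.
split.
- by move=> i; exact: maclaren_monadic.
- move=> i k; apply/funext => x; apply/funext => y; apply/propext.
  by split; apply: maclaren_rel_comm => // z; exact: cqia_dia_comm hA _ _ _.
- by move=> i k; rewrite /maclaren_diag (cqia_diag_sym hA).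
- by move=> i k; exact: psi_closed (mqia_bounded (hM i)) _.
- move=> i; rewrite /maclaren_diag (cqia_diag_refl hA).
  by apply/seteqP; split=> // x _; exact: le_one (mqia_bounded (hM i)) _.
move=> i k l ik lk; have hB := mqia_bounded (hM k).
have dil := cqia_diag_dia hA ik lk.
apply/seteqP; split=> y.
  move=> [w [wik wkl] wy]; rewrite /maclaren_diag /maclaren_psi /= -dil.
  exact: (le_trans hB wy (dia_mono (hM k) (le_meet hB wik wkl))).
rewrite /maclaren_diag /maclaren_psi /= -dil.
set m := imp (imp _ _) zero => ym.
have m0 : m <> zero.
  move=> m0; apply: (svalP y); apply: (le_zero hB).
  by move: ym; rewrite m0 (mqia_dia_zero (hM k)).
exists (exist _ m m0) => //.
by split; [exact: meet_le_l | exact: meet_le_r].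
Qed.
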